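(* Let $\alpha$ be a positive integer and let $c>1$ be an integer constant. (1) For any leader election algorithm with advice working in time at most $D+\phi+c$ in all feasible graphs of diameter $D$ and election index $\phi$, there exist graphs with election index at most $\alpha$ in which this algorithm requires advice of size $\Omega(\log\alpha)$. (2) For any leader election algorithm with advice working in time at most $D+c\phi$ in all feasible graphs of diameter $D$ and election index $\phi$, there exist graphs with election index at most $\alpha$ in which this algorithm requires advice of size $\Omega(\log\log\alpha)$. (3) For any leader election algorithm with advice working in time at most $D+\phi^{c}$ in all feasible graphs of diameter $D$ and election index $\phi$, there exist graphs with election index at most $\alpha$ in which this algorithm requires advice of size $\Omega(\log\log\log\alpha)$. (4) For any leader election algorithm with advice working in time at most $D+c^{\phi}$ in all feasible graphs of diameter $D$ and election index $\phi$, there exist graphs with election index at most $\alpha$ in which this algorithm requires advice of size $\Omega(\log(\log^*\alpha))$.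
   Context: A graph is a simple undirected connected finite graph whose nodes have no identifiers; at each node $v$ of degree $d$ the incident edges carry distinct port numbers $0,\dots,d-1$ (local to each node). The truncated view $\mathcal{V}^0(v)$ is a single node; $\mathcal{V}^{l+1}(v)$ is the port-labelled rooted tree whose root has, for every neighbour $v_i$ of $v$, a child $x_i$ joined by an edge carrying the same two port numbers as $\{v,v_i\}$ (the one at $v$ at the root side), and $x_i$ is the root of a copy of $\mathcal{V}^l(v_i)$. The augmented truncated view $\mathcal{B}^l(v)$ is $\mathcal{V}^l(v)$ with each leaf labelled by the degree in $G$ of the node it represents. A graph is feasible if for some $l$ the views $\mathcal{B}^l(v)$ of all nodes are pairwise distinct; its election index $\phi$ is the smallest such $l$. Model (LOCAL): synchronous rounds, all nodes start simultaneously, in each round every node exchanges arbitrary messages with all neighbours and computes arbitrarily. Leader election: every node $v$ outputs a sequence $(p_1,q_1,\dots,p_k,q_k)$ of nonnegative integers describing a simple path starting at $v$ whose $i$-th edge has port $p_i$ at its endpoint closer to $v$ and $q_i$ at the other endpoint; all these paths must end at a common node. Time is the number of rounds until all nodes output. Advice: an oracle knowing the entire port-labelled graph gives the same binary string to all nodes before the start; its length is the size of advice. In a deterministic algorithm with advice, the actions/output of node $v$ in round $r$ are a function of the advice and of $\mathcal{B}^r(v)$. $D$ denotes the diameter of the graph. Logarithms are base 2; $\log^*$ is the iterated logarithm; $\Omega(\cdot)$ is asymptotic in $\alpha$. *)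

(* Defs.v *)
From Stdlib Require Import Reals.
From mathcomp Require Import all_boot.


(* Port-labelled graphs.  Nodes are 'I_n (the identities are only an  *)
(* artefact of the representation; nodes never see them).  At node v  *)
(* the neighbour reached through port p is [nth _ (gnb G v) p]; hence *)
(* the ports at v are 0..deg v - 1 and deg v = size (gnb G v).        *)
Record pgraph := PGraph { gn : nat; gnb : 'I_gn -> seq 'I_gn }.

Notation node G := ('I_(gn G)).

Definition deg (G : pgraph) (v : node G) : nat := size (gnb G v).

(* port at u of the edge {u,v} (meaningful when v is a neighbour of u) *)
Definition port (G : pgraph) (u v : node G) : nat := index v (gnb G u).

Definition adjrel (G : pgraph) : rel (node G) := fun x y => y \in gnb G x.

Definition walk (G : pgraph) (u v : node G) (k : nat) : Prop :=
  exists p : seq (node G), [/\ path (adjrel G) u p, last u p = v & size p = k].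

Definition wf_graph (G : pgraph) : Prop :=
  [/\ 0 < gn G,
      forall v : node G, uniq (gnb G v),
      forall v : node G, v \notin gnb G v,
      forall u v : node G, (u \in gnb G v) = (v \in gnb G u)
    & forall u v : node G, exists k, walk G u v k].

Definition diameter (G : pgraph) (D : nat) : Prop :=
  (forall u v : node G, exists k, k <= D /\ walk G u v k) /\
  (exists u v : node G, forall k, walk G u v k -> D <= k).

(* Augmented truncated views B^l(v).                                  *)
(* VLeaf d : a leaf labelled by the degree d of the node it represents *)
(* VNode cs : the i-th element (q, t) of cs is the child reached       *)
(*            through port i at this node, q is the port at the child, *)
(*            and t is the subtree rooted at the child.                *)
Inductive view : Type :=
| VLeaf of nat
| VNode of seq (nat * view).

Fixpoint aug_view (G : pgraph) (l : nat) (v : node G) : view :=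
  match l with
  | 0 => VLeaf (deg G v)
  | l'.+1 => VNode [seq (port G u v, aug_view G l' u) | u <- gnb G v]
  end.

Definition feasible (G : pgraph) : Prop :=
  exists l, injective (aug_view G l).

Definition election_index (G : pgraph) (phi : nat) : Prop :=
  injective (aug_view G phi) /\ (forall l, l < phi -> ~ injective (aug_view G l)).

Fixpoint trace (G : pgraph) (v : node G) (s : seq nat) {struct s}
  : option (seq (node G)) :=
  match s with
  | [::] => Some [:: v]
  | p :: q :: s' =>
      if p < deg G v then
        let u := nth v (gnb G v) p in
        if port G u v == q then omap (cons v) (trace G u s') else None
      else None
  | _ => None
  end.

Definition leads_to (G : pgraph) (v : node G) (s : seq nat) (w : node G) : Prop :=
  exists vs, [/\ trace G v s = Some vs, uniq vs & last v vs = w].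

(* Deterministic algorithms with advice (LOCAL model).                *)
(* oracle G : the advice string given to all nodes of G.               *)
(* decide A r B : the action of a node in round r with advice A and   *)
(* augmented view B = B^r(v): None = no output yet, Some s = output s. *)
Record algorithm := Algorithm {
  oracle : pgraph -> seq bool;
  decide : seq bool -> nat -> view -> option (seq nat) }.

Definition outputs_at (A : algorithm) (G : pgraph) (v : node G) (r : nat)
  (s : seq nat) : Prop :=
  decide A (oracle A G) r (aug_view G r v) = Some s /\
  (forall r', r' < r -> decide A (oracle A G) r' (aug_view G r' v) = None).

Definition elects_within (A : algorithm) (tb : nat -> nat -> nat) : Prop :=
  forall (G : pgraph) (D phi : nat),
    wf_graph G -> diameter G D -> election_index G phi ->
    exists w : node G, forall v : node G,
      exists r s, [/\ r <= tb D phi, outputs_at A G v r s & leads_to G v s w].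

Definition log2 (x : R) : R := Rdiv (ln x) (ln 2).

Fixpoint logstar_fuel (f : nat) (x : R) : nat :=
  match f with
  | 0 => 0
  | f'.+1 => if Rle_dec x 1 then 0 else (logstar_fuel f' (log2 x)).+1
  end.

(* log* n = least k such that k-fold iterated log2 of n is <= 1;      *)
(* n steps of fuel always suffice.                                    *)
Definition logstar (n : nat) : nat := logstar_fuel n (INR n).

Definition advice_lower_bound (A : algorithm) (g : nat -> R) : Prop :=
  exists K : R, Rlt 0 K /\
  exists a0 : nat, forall alpha : nat, a0 <= alpha ->
    exists (G : pgraph) (phi : nat),
      [/\ wf_graph G, election_index G phi, phi <= alpha
        & Rle (Rmult K (g alpha)) (INR (size (oracle A G)))].

(* Main.v *)
Require Import Defs.
From Stdlib Require Import Reals ZArith Lia Lra Classical.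
From mathcomp Require Import all_boot zify.

Set Implicit Arguments.
Unset Strict Implicit.
Unset Printing Implicit Defensive.

(** A word over the naturals is realised as a ring whose nodes carry as many pendant leaves
    as their letter says; the view of radius [l] of a ring node then amounts to the window of
    radius [l] of the word around it, while the ports listed in an output path determine its
    signed displacement along the ring.

    In a ring of length [n] with advice [a], the displacements output by consecutive nodes
    cannot drop by exactly one all the way around, so some adjacent pair disagrees.  What that
    pair sees within its time bound [n/2 + T(phi) + O(1)] is a word slightly longer than one
    turn, and every sufficiently long ring containing this word ("block") as a factor must
    get advice different from [a].  Cutting the ring open in this way and closing it with
    fresh letters repeats only about [2 T(phi)] letters, so the election index grows from
    [phi] to [T(phi) + O(1)] only, however large the diameter is.

    Suppose blocks excluding a set [S] of advice strings exist with arbitrarily large letters.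
    A ring made of two of them with disjoint letters gets advice outside [S], and cutting it
    spares one of the two blocks; so its cut excludes one more string.  Excluding
    all [2 ^ L - 1] strings shorter than [L] is impossible, hence advice of size [L] is needed
    as soon as the [2 ^ L]-th iterate of [r |-> T(r + 1) + 3] is below [alpha]. *)

(** * Port-labelled graphs over an arbitrary finite type of nodes *)

Section FinGraph.

Variables (T : finType) (nb : T -> seq T).

Definition fgraph : pgraph :=
  PGraph #|T| (fun v => [seq enum_rank u | u <- nb (enum_val v)]).

Fixpoint fview (l : nat) (x : T) : view :=
  match l with
  | 0 => VLeaf (size (nb x))
  | l'.+1 => VNode [seq (index x (nb u), fview l' u) | u <- nb x]
  end.

Lemma fviewS l x :
  fview l.+1 x = VNode [seq (index x (nb u), fview l u) | u <- nb x].
Proof. by []. Qed.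

Lemma gnb_fgraph x : gnb fgraph (enum_rank x) = [seq enum_rank u | u <- nb x].
Proof. by rewrite /= enum_rankK. Qed.

Lemma port_fgraph x y : port fgraph (enum_rank x) (enum_rank y) = index y (nb x).
Proof. by rewrite /port gnb_fgraph index_map //; apply: enum_rank_inj. Qed.

Lemma aug_view_fgraph l x : aug_view fgraph l (enum_rank x) = fview l x.
Proof.
elim: l x => [|l IHl] x; first by rewrite /= /deg gnb_fgraph size_map.
rewrite [LHS]/= enum_rankK -map_comp /=; congr VNode.
by apply: eq_map => u /=; rewrite port_fgraph IHl.
Qed.

Definition fwalk x y k :=
  exists p, [/\ path (fun a b => b \in nb a) x p, last x p = y & size p = k].

Lemma walk_fgraph x y k : fwalk x y k -> walk fgraph (enum_rank x) (enum_rank y) k.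
Proof.
case=> p [pathp lastp sizep]; exists [seq enum_rank u | u <- p].
split; [|by rewrite last_map lastp|by rewrite size_map].
rewrite path_map; apply: sub_path pathp => a b nb_ab.
by rewrite /= /adjrel gnb_fgraph mem_map //; apply: enum_rank_inj.
Qed.

Lemma fwalk_cat x y z j k : fwalk x y j -> fwalk y z k -> fwalk x z (j + k).
Proof.
case=> p [pathp lastp <-] [q [pathq lastq <-]]; exists (p ++ q).
by rewrite cat_path pathp lastp pathq last_cat lastp lastq size_cat.
Qed.

Lemma wf_fgraph :
  0 < #|T| -> (forall x, uniq (nb x)) -> (forall x, x \notin nb x) ->
  (forall x y, (x \in nb y) = (y \in nb x)) ->
  (forall x y, exists k, fwalk x y k) -> wf_graph fgraph.
Proof.
move=> T0 nbU nbI nbS conn; have inj := @enum_rank_inj T.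
split=> //.
- by move=> v; rewrite map_inj_uniq.
- by move=> v; rewrite -{1}(enum_valK v) mem_map.
- move=> u v; rewrite -(enum_valK u) -(enum_valK v) !gnb_fgraph !mem_map //.
- move=> u v; have [k wk] := conn (enum_val u) (enum_val v).
  by exists k; rewrite -(enum_valK u) -(enum_valK v); apply: walk_fgraph.
Qed.

End FinGraph.

(** * Views on the infinite line with pendant leaves *)

Local Open Scope Z_scope.

(* Views in the infinite line whose node [z] carries [f z] pendant leaves. *)
Fixpoint rview (f : Z -> nat) (l : nat) (z : Z) : view :=
  match l with
  | 0%N => VLeaf (f z).+2
  | l1.+1 => VNode ((1%N, rview f l1 (z + 1)) :: (0%N, rview f l1 (z - 1)) ::
      [seq (0%N, if l1 is l2.+1 then VNode [:: (k.+2, rview f l2 z)]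
                 else VLeaf 1) | k <- iota 0 (f z)])
  end.

(** View of a leaf pendant at [z]; its edge has port [k.+2] there, ports 0 and 1 being those of the
    line. [rview] inlines this term, which keeps its recursion structural. *)
Definition pview (f : Z -> nat) (l : nat) (z : Z) (k : nat) : view :=
  if l is l2.+1 then VNode [:: (k.+2, rview f l2 z)] else VLeaf 1.

Lemma rviewS f l z :
  rview f l.+1 z = VNode ((1%N, rview f l (z + 1)) :: (0%N, rview f l (z - 1)) ::
                            [seq (0%N, pview f l z k) | k <- iota 0 (f z)]).
Proof. by case: l. Qed.

Definition same_window (f g : Z -> nat) (x y : Z) (l : nat) : Prop :=
  forall t, - Z.of_nat l <= t <= Z.of_nat l -> f (x + t) = g (y + t).

Lemma same_window_sub f g x y l x' y' l' :
  same_window f g x y l -> x' - x = y' - y ->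
  Z.abs (x' - x) + Z.of_nat l' <= Z.of_nat l -> same_window f g x' y' l'.
Proof.
move=> win exy le t bt.
have -> : x' + t = x + (x' - x + t) by lia.
have -> : y' + t = y + (x' - x + t) by lia.
by apply: win; lia.
Qed.

(** The induction is strong because entering a leaf returns to the same node with the radius reduced
    by two. *)
Lemma rview_window f g x y l : same_window f g x y l -> rview f l x = rview g l y.
Proof.
have [m] := ubnP l; elim: m l x y => // m IHm [|l] x y lem win.
  by have := win 0; rewrite /= !Z.add_0_r => -> //.
have sub i : - 1 <= i <= 1 -> same_window f g (x + i) (y + i) l.
  by move=> bi; apply: same_window_sub win _ _; lia.
rewrite !rviewS; congr (VNode ((_, _) :: (_, _) :: _)).
- by apply: IHm; [lia | apply: sub; lia].
- by apply: IHm; [lia | apply: (sub (-1)); lia].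
have -> : f x = g y by have := win 0; rewrite !Z.add_0_r; apply; lia.
apply: eq_map => k; congr (_, _); case: l lem win sub => //= l lem win _.
by congr (VNode [:: (_, _)]); apply: IHm; [lia | apply: same_window_sub win _ _; lia].
Qed.

(** The first two children give the windows around both neighbours, which cover everything except,
    when these have radius 0, the centre; the number of pendant children gives the letter there. *)
Lemma window_rview f g x y l : rview f l x = rview g l y -> same_window f g x y l.
Proof.
elim: l x y => [|l IHl] x y.
  move=> [efg] t bt; have -> : t = 0 by lia.
  by rewrite !Z.add_0_r.
rewrite !rviewS => -[/IHl winr /IHl winl epend] t bt.
have [->|tn0] := Z.eq_dec t 0.
  by have := congr1 size epend; rewrite !size_map !size_iota !Z.add_0_r.
have [tpos|tneg] := Z_lt_dec 0 t.
  replace (x + t) with (x + 1 + (t - 1)) by lia.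
  by replace (y + t) with (y + 1 + (t - 1)) by lia; apply: winr; lia.
replace (x + t) with (x - 1 + (t + 1)) by lia.
by replace (y + t) with (y - 1 + (t + 1)) by lia; apply: winl; lia.
Qed.

(** * Rings with pendant leaves *)

Section Ring.

(* The length is [n.+3], as both neighbours of a node on a shorter ring would coincide. *)
Variables (n : nat) (w : seq nat).

Local Notation len := (Z.of_nat n.+3).

Definition rpos (z : Z) : 'I_n.+3 := inord (Z.to_nat (z mod len)).

Definition letter (z : Z) : nat := nth 0%N w (rpos z).

Lemma rposE z : Z.of_nat (rpos z) = z mod len.
Proof. by rewrite inordK; have := Z.mod_pos_bound z len; lia. Qed.

Lemma rpos_ord (i : 'I_n.+3) : rpos (Z.of_nat i) = i.
Proof.
apply: val_inj; apply: Nat2Z.inj; rewrite rposE Z.mod_small //.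
by have := ltn_ord i; lia.
Qed.

Lemma rpos_eq z z' : rpos z = rpos z' <-> exists q, z' = z + q * len.
Proof.
split=> [e|[q ->]].
  exists (z' / len - z / len).
  have := congr1 (fun i : 'I__ => Z.of_nat i) e; rewrite /= !rposE => em.
  have := Z.div_mod z len; have := Z.div_mod z' len; nia.
by apply: val_inj; apply: Nat2Z.inj; rewrite !rposE Z_mod_plus_full.
Qed.

Lemma rposD z z' t : rpos z = rpos z' -> rpos (z + t) = rpos (z' + t).
Proof. by move=> /rpos_eq[q ->]; apply/rpos_eq; exists q; lia. Qed.

Lemma rpos_small z z' : rpos z = rpos z' -> Z.abs (z' - z) < len -> z = z'.
Proof.
move=> /rpos_eq[q ->] lt; suff -> : q = 0 by lia.
have [//|[?|?]] : q = 0 \/ 1 <= q \/ q <= -1 by lia.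
  by nia.
by nia.
Qed.

Definition rtype := {i : 'I_n.+3 & option 'I_(nth 0%N w i)}.

Definition rnode (i : 'I_n.+3) : rtype := existT _ i None.

Definition pend (i : 'I_n.+3) (k : 'I_(nth 0%N w i)) : rtype := existT _ i (Some k).

(** The ring is consistently oriented, port 0 leading forward at every ring node, so that ring nodes
    can be told apart only by the letters around them. *)
Definition rnb (x : rtype) : seq rtype :=
  match x with
  | existT i None => rnode (rpos (Z.of_nat i + 1)) :: rnode (rpos (Z.of_nat i - 1)) ::
                       [seq pend k | k <- enum 'I_(nth 0%N w i)]
  | existT i (Some k) => [:: rnode i]
  end.

Lemma pend_inj i : injective (@pend i).
Proof. by move=> k k' /eqP; rewrite eq_Tagged => /eqP[]. Qed.

Lemma rnode_inj : injective rnode.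
Proof. by move=> i j []. Qed.

Lemma rnode_notin_pend i (j : 'I_n.+3) : rnode i \notin [seq pend k | k <- enum 'I_(nth 0%N w j)].
Proof. by apply/negP => /mapP[k _]. Qed.

Lemma rnbE z : rnb (rnode (rpos z)) =
  rnode (rpos (z + 1)) :: rnode (rpos (z - 1)) ::
    [seq pend k | k <- enum 'I_(nth 0%N w (rpos z))].
Proof.
have e t : rpos (Z.of_nat (rpos z) + t) = rpos (z + t) by apply: rposD; rewrite rpos_ord.
by rewrite /= e (e (-1)).
Qed.

Lemma rnode_neq z z' : z <> z' -> Z.abs (z' - z) < len -> rnode (rpos z) != rnode (rpos z').
Proof. by move=> ne lt; apply/eqP => /rnode_inj/rpos_small/(_ lt). Qed.

Lemma index_next z : index (rnode (rpos z)) (rnb (rnode (rpos (z + 1)))) = 1%N.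
Proof.
rewrite rnbE /= (negPf (rnode_neq _ _)); try lia.
by rewrite Z.add_simpl_r eqxx.
Qed.

Lemma index_prev z : index (rnode (rpos z)) (rnb (rnode (rpos (z - 1)))) = 0%N.
Proof. by rewrite rnbE /= Z.sub_add eqxx. Qed.

Lemma index_pend (i : 'I_n.+3) (k : 'I_(nth 0%N w i)) : index (pend k) (rnb (rnode i)) = k.+2.
Proof.
have neq j : (rnode j == pend k) = false by apply/negP => /eqP.
by rewrite /= !neq index_map ?index_enum_ord //; apply: pend_inj.
Qed.

Lemma fview_ring l z :
  fview rnb l (rnode (rpos z)) = rview letter l z /\
  forall k : 'I_(nth 0%N w (rpos z)), fview rnb l (pend k) = pview letter l z k.
Proof.
elim: l z => [|l IHl] z; first by rewrite /= size_map size_enum_ord.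
split=> [|k]; last first.
  rewrite /pview -(proj1 (IHl z)); congr (VNode [:: (_, _)]).
  exact: index_pend.
rewrite rviewS fviewS rnbE.
rewrite !map_cons index_next index_prev (proj1 (IHl (z + 1))) (proj1 (IHl (z - 1))).
congr (VNode [:: _, _ & _]).
rewrite -map_comp -[iota _ _]val_enum_ord -map_comp.
by apply: eq_map => k; rewrite /= (proj2 (IHl z)) eqxx.
Qed.

Definition ring : pgraph := fgraph rnb.

Lemma rtype_cases (x : rtype) :
  exists z, x = rnode (rpos z) \/ exists k : 'I_(nth 0%N w (rpos z)), x = pend k.
Proof.
case: x => i o; exists (Z.of_nat i); rewrite rpos_ord.
by case: o => [k|]; [right; exists k | left].
Qed.

Lemma aug_view_rnode l z : aug_view ring l (enum_rank (rnode (rpos z))) = rview letter l z.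
Proof. by rewrite aug_view_fgraph (proj1 (fview_ring l z)). Qed.

(** The extra round serves the leaves, which see their ring node one step later. A leaf is never
    confused with a ring node, since it has a single neighbour. *)
Lemma aug_view_ring_inj l :
  (forall z z', same_window letter letter z z' l -> rpos z = rpos z') ->
  injective (aug_view ring l.+1).
Proof.
move=> winU u v; rewrite -(enum_valK u) -(enum_valK v) !aug_view_fgraph => eview.
congr enum_rank; move: (enum_val u) (enum_val v) eview => {u v} x y.
have [z [->|[k ->]]] := rtype_cases x; have [z' [->|[k' ->]]] := rtype_cases y;
  rewrite ?(proj1 (fview_ring _ _)) ?(proj2 (fview_ring _ _)).
- move/window_rview => win; congr rnode; apply: winU.
  by apply: same_window_sub win _ _; lia.
- by rewrite rviewS.
- by rewrite rviewS.
- move=> [ek /window_rview/winU ez]; move: k k' ek; rewrite ez => k k' ek.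
  by congr pend; apply: val_inj.
Qed.

Lemma mem_rnb_sym x y : x \in rnb y -> y \in rnb x.
Proof.
have [z [->|[k ->]]] := rtype_cases y; last first.
  by rewrite mem_seq1 => /eqP ->; rewrite !inE map_f ?mem_enum ?orbT.
rewrite rnbE !inE => /or3P[/eqP->|/eqP->|/mapP[k _ ->]]; last by rewrite /= inE.
  by rewrite rnbE !inE Z.add_simpl_r eqxx orbT.
by rewrite rnbE !inE Z.sub_add eqxx.
Qed.

Lemma fwalk_next z k : fwalk rnb (rnode (rpos z)) (rnode (rpos (z + Z.of_nat k))) k.
Proof.
elim: k => [|k IHk]; first by exists [::]; split; rewrite /= ?Z.add_0_r.
rewrite -(addn1 k); apply: (fwalk_cat IHk).
exists [:: rnode (rpos (z + Z.of_nat (k + 1)))]; split=> //.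
by rewrite /path rnbE inE; replace (z + Z.of_nat (k + 1)) with (z + Z.of_nat k + 1) by lia;
   rewrite eqxx.
Qed.

Lemma fwalk_prev z k : fwalk rnb (rnode (rpos z)) (rnode (rpos (z - Z.of_nat k))) k.
Proof.
elim: k => [|k IHk]; first by exists [::]; split; rewrite /= ?Z.sub_0_r.
rewrite -(addn1 k); apply: (fwalk_cat IHk).
exists [:: rnode (rpos (z - Z.of_nat (k + 1)))]; split=> //.
by rewrite /path rnbE !inE; replace (z - Z.of_nat (k + 1)) with (z - Z.of_nat k - 1) by lia;
   rewrite eqxx orbT.
Qed.

Lemma fwalk_ring i j : exists2 k, (k <= n.+3./2)%N & fwalk rnb (rnode i) (rnode j) k.
Proof.
pose a := Z.of_nat i; pose b := Z.of_nat j.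
have [lti ltj] := (ltn_ord i, ltn_ord j).
have around q k : b = a + Z.of_nat k + q * len -> fwalk rnb (rnode i) (rnode j) k.
  move=> eb; rewrite -(rpos_ord i) -(rpos_ord j) -/a -/b.
  by have <- : rpos (a + Z.of_nat k) = rpos b; [apply/rpos_eq; exists q | apply: fwalk_next].
have around' q k : b = a - Z.of_nat k + q * len -> fwalk rnb (rnode i) (rnode j) k.
  move=> eb; rewrite -(rpos_ord i) -(rpos_ord j) -/a -/b.
  by have <- : rpos (a - Z.of_nat k) = rpos b; [apply/rpos_eq; exists q | apply: fwalk_prev].
have [leij|ltji] := leqP i j.
  have [small|big] := leqP (j - i) n.+3./2.
    by exists (j - i)%N => //; apply: (around 0); lia.
  by exists (n.+3 - (j - i))%N; [lia | apply: (around' 1); lia].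
have [small|big] := leqP (i - j) n.+3./2.
  by exists (i - j)%N => //; apply: (around' 0); lia.
by exists (n.+3 - (i - j))%N; [lia | apply: (around (-1)); lia].
Qed.

Lemma fwalk_ring_diameter x y : exists2 k, (k <= n.+3./2 + 2)%N & fwalk rnb x y k.
Proof.
have stem u : exists2 k, (k <= 1)%N & fwalk rnb u (rnode (tag u)) k /\
                                       fwalk rnb (rnode (tag u)) u k.
  have [z [->|[k ->]]] := rtype_cases u; first by exists 0%N => //; split; exists [::].
  exists 1%N => //; split; first by exists [:: rnode (rpos z)]; rewrite /= inE eqxx.
  by exists [:: pend k]; split=> //=; rewrite !inE map_f ?mem_enum ?orbT.
have [[a lea [xa _]] [b leb [_ by_]]] := (stem x, stem y).
have [k lek wk] := fwalk_ring (tag x) (tag y).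
by exists (a + k + b)%N; [lia | apply: fwalk_cat (fwalk_cat xa wk) by_].
Qed.

Lemma wf_ring : wf_graph ring.
Proof.
apply: wf_fgraph.
- by apply/card_gt0P; exists (rnode ord0).
- move=> x; have [z [->|[k ->]]] := rtype_cases x => //.
  rewrite rnbE /= inE negb_or !rnode_notin_pend rnode_neq; try lia.
  by rewrite map_inj_uniq ?enum_uniq //; apply: pend_inj.
- move=> x; have [z [->|[k ->]]] := rtype_cases x.
    by rewrite rnbE !inE !negb_or rnode_notin_pend !rnode_neq; lia.
  by rewrite inE; apply/negP => /eqP.
- by move=> x y; apply/idP/idP; apply: mem_rnb_sym.
- by move=> x y; have [k _ wk] := fwalk_ring_diameter x y; exists k.
Qed.

(* Among the port pairs of a ring only [(0, 1)] and [(1, 0)] belong to ring edges: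
   a pendant edge has port at least 2 at its ring node. *)
Definition step (p q : nat) : Z :=
  match p, q with
  | 0%N, 1%N => 1
  | 1%N, 0%N => -1
  | _, _ => 0
  end.

Fixpoint displacement (s : seq nat) : Z :=
  if s is p :: q :: s' then step p q + displacement s' else 0.

Lemma tag_step x p z (u := nth x (rnb x) p) :
  (p < size (rnb x))%N -> tag x = rpos z -> tag u = rpos (z + step p (index x (rnb u))).
Proof.
rewrite /u {u}; have [z' [->|[k ->]]] := rtype_cases x; last first.
  rewrite ltnS leqn0 => /eqP -> ez.
  change (rpos z' = rpos (z + step 0 (index (pend k) (rnb (rnode (rpos z')))))).
  by rewrite index_pend Z.add_0_r.
move=> ltp ez; rewrite rnbE; rewrite rnbE in ltp.
case: p ltp => [_|[_|p ltp]]; rewrite [nth _ _ _]/=.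
- by rewrite index_next; apply: rposD.
- by rewrite index_prev; apply: (rposD (-1)).
- rewrite /= size_map size_enum_ord !ltnS in ltp.
  by rewrite (nth_map (Ordinal ltp)) ?size_enum_ord //= Z.add_0_r.
Qed.

Lemma last_trace G (u v : node G) s vs : trace G v s = Some vs -> last u vs = last v vs.
Proof.
case: s => [|p [|q s]] //=; first by case=> <-.
case: ifP => // _; case: ifP => // _.
by case: (trace _ _ _) => //= vs' [<-].
Qed.

Lemma trace_displacement (v : node ring) s vs z :
  trace ring v s = Some vs -> tag (enum_val v) = rpos z ->
  tag (enum_val (last v vs)) = rpos (z + displacement s).
Proof.
have [m] := ubnP (size s); elim: m s v vs z => // m IHm [|p [|q s]] v vs z //.
  by move=> _ [<-] /= ->; rewrite Z.add_0_r.
move=> /= lts; case: ifP => // ltp; case: ifP => // /eqP eq_q.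
set u := nth _ _ _ in eq_q *; case etr: (trace _ _ _) => [vs'|] //= [<-] ez /=.
rewrite (last_trace v etr) Z.add_assoc; apply: IHm etr _; first by lia.
set x := enum_val v in u eq_q ez *.
have eu : u = enum_rank (nth x (rnb x) p).
  by rewrite /u -{1}(enum_valK v) (nth_map x) //; move: ltp; rewrite /deg size_map.
have <- : index x (rnb (nth x (rnb x) p)) = q.
  by rewrite -eq_q eu -(enum_valK v) port_fgraph.
rewrite eu enum_rankK; apply: tag_step ez.
by move: ltp; rewrite /deg size_map.
Qed.

End Ring.

(* Minima, short bit strings and a pigeonhole principle *)
Local Close Scope Z_scope.

Lemma exists_least (P : nat -> Prop) n :
  P n -> exists2 m, m <= n & P m /\ forall k, k < m -> ~ P k.
Proof.
elim/ltn_ind: n => n IHn Pn; have [[k ltk Pk]|none] := classic (exists2 k, k < n & P k).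
  by have [m lem minm] := IHn k ltk Pk; exists m => //; apply: leq_trans lem (ltnW ltk).
by exists n => //; split=> // k ltk Pk; apply: none; exists k.
Qed.

Lemma election_index_exists G l :
  injective (aug_view G l) -> exists2 phi, phi <= l & election_index G phi.
Proof. exact: exists_least. Qed.

Lemma diameter_exists G d :
  0 < gn G -> (forall u v : node G, exists2 k, k <= d & walk G u v k) ->
  exists2 D, D <= d & diameter G D.
Proof.
move=> G0 dP; pose P e := forall u v : node G, exists k, k <= e /\ walk G u v k.
have [|D leD [PD minD]] := @exists_least P d.
  by move=> u v; have [k] := dP u v; exists k.
exists D => //; split=> //; case: D PD minD {leD} => [|D] _ minD.
  by exists (Ordinal G0), (Ordinal G0).
apply: NNPP => nofar; apply: (minD D) => // u v; apply: NNPP => far.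
apply: nofar; exists u, v => k wk; rewrite ltnNge; apply/negP => lek.
by apply: far; exists k.
Qed.

Fixpoint strings (L : nat) : seq (seq bool) :=
  if L is L'.+1 then
    [::] :: [seq true :: s | s <- strings L'] ++ [seq false :: s | s <- strings L']
  else [::].

Lemma mem_strings L s : size s < L -> s \in strings L.
Proof.
elim: L s => // L IHL [|b s] //= lts; rewrite inE mem_cat /=.
by case: b; rewrite map_f ?orbT ?IHL.
Qed.

Lemma size_strings L : (size (strings L)).+1 = 2 ^ L.
Proof. by elim: L => //= L IHL; rewrite size_cat !size_map expnS -IHL; lia. Qed.

(** Used to exchange quantifiers: the string newly excluded depends on the lower bound put on the
    letters, but among finitely many strings one must serve all bounds. *)
Lemma pigeonhole_antitone (U : eqType) (E : seq U) (P : U -> nat -> Prop) :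
  (forall x m n, m <= n -> P x n -> P x m) -> (forall n, exists2 x, x \in E & P x n) ->
  exists2 x, x \in E & forall n, P x n.
Proof.
move=> anti; elim: E => [|x E IHE] ex; first by have [] := ex 0.
have [allx|/not_all_ex_not[n0 nPx]] := classic (forall n, P x n).
  by exists x; rewrite ?mem_head.
have [|y yE Py] := IHE; last by exists y; rewrite // inE yE orbT.
move=> n; have [y] := ex (maxn n n0); rewrite inE => /predU1P[->|yE] Py.
  by case: nPx; apply: anti Py; rewrite leq_maxr.
by exists y => //; apply: anti Py; rewrite leq_maxl.
Qed.

(** * Blocks, and rings spelled by two blocks *)

Local Open Scope Z_scope.

Definition occurs (W : seq nat) (f : Z -> nat) (o : Z) : Prop :=
  forall k, (k < size W)%N -> f (o + Z.of_nat k) = nth 0%N W k.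

Lemma nth_in (s : seq nat) i : (i < size s)%N -> nth 0%N s i \in s.
Proof. exact: mem_nth. Qed.

Lemma last_in (s : seq nat) : (0 < size s)%N -> last 0%N s \in s.
Proof. by case: s => // x s _; apply: mem_last. Qed.

Lemma occurs_catl W1 W2 f o : occurs (W1 ++ W2) f o -> occurs W1 f o.
Proof. by move=> occ k ltk; rewrite occ ?nth_cat ?ltk // size_cat; lia. Qed.

Lemma occurs_catr W1 W2 f o :
  occurs (W1 ++ W2) f o -> occurs W2 f (o + Z.of_nat (size W1)).
Proof.
move=> occ k ltk; have := occ (size W1 + k)%N; rewrite size_cat nth_cat.
have -> : (size W1 + k < size W1)%N = false by lia.
by rewrite addKn => <-; [congr f | ]; lia.
Qed.

Lemma letter_nth n w z k : (k < n.+3)%N -> rpos n z = rpos n (Z.of_nat k) ->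
  letter n w z = nth 0%N w k.
Proof. by rewrite /letter => ltk ->; rewrite (rpos_ord (Ordinal ltk)). Qed.

Lemma letter_occurs n w z : size w = n.+3 -> rpos n z = rpos n 0 -> occurs w (letter n w) z.
Proof.
move=> sw ez k ltk; apply: letter_nth; first by rewrite -sw.
by rewrite (rposD _ ez).
Qed.

Lemma letter_mem n w z : size w = n.+3 -> letter n w z \in w.
Proof. by move=> sw; rewrite mem_nth // sw. Qed.

(* [N] bounds the letters from below, [l] is the radius at which windows become unique;
   the last letter separates the block from whatever follows it. *)
Definition block (N l : nat) (W : seq nat) : Prop :=
  [/\ (1 < size W)%N,
      all (leq N) W,
      forall k, (k < size W)%N -> nth 0%N W k = last 0%N W -> k.+1 = size W
    & forall i j, (i + 2 * l < size W)%N -> (j + 2 * l < size W)%N ->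
        (forall t, (t <= 2 * l)%N -> nth 0%N W (i + t) = nth 0%N W (j + t)) -> i = j].

Lemma block_weaken M N l W : (M <= N)%N -> block N l W -> block M l W.
Proof.
by move=> leMN [W1 WN Wl Ww]; split=> //; apply: sub_all WN => k; apply: leq_trans.
Qed.

Section TwoBlocks.

Variables (N l : nat) (W1 W2 : seq nat).
Hypotheses (B1 : block N l W1) (B2 : block N l W2).
Hypothesis disj : forall a, a \in W1 -> a \notin W2.

Local Notation w := (W1 ++ W2).

Lemma last_unique1 k :
  (k < size w)%N -> nth 0%N w k = nth 0%N w (size W1).-1 -> k = (size W1).-1.
Proof.
case: B1 => W1s _ W1l _; rewrite size_cat !nth_cat => ltk.
have -> : ((size W1).-1 < size W1)%N by lia.
rewrite nth_last; case: ltnP => [ltk1|gek1] e; first by have := W1l k ltk1 e; lia.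
have := @nth_in W2 (k - size W1); rewrite e => inW2.
have inW1 : last 0%N W1 \in W1 by apply: last_in; lia.
by case/negP: (disj inW1); apply: inW2; lia.
Qed.

Lemma last_unique2 k :
  (k < size w)%N -> nth 0%N w k = nth 0%N w (size w).-1 -> k = (size w).-1.
Proof.
case: B2 => W2s _ W2l _; rewrite !nth_last last_cat.
have -> : last (last 0%N W1) W2 = last 0%N W2 by case: (W2) W2s.
rewrite size_cat nth_cat => ltk.
case: ltnP => [ltk1|gek1] e.
  have := nth_in ltk1; rewrite e => /disj/negP[].
  by apply: last_in; lia.
by have := W2l (k - size W1)%N _ e; lia.
Qed.

(** A window either contains the last letter of a block, which occurs only once on the ring, or lies
    inside one block. In the latter case disjointness of the letters identifies the block, and the
    block's own uniqueness of windows the position. *)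
Lemma two_blocks_window n z z' : size w = n.+3 ->
  same_window (letter n w) (letter n w) z z' l -> rpos n z = rpos n z'.
Proof.
move=> sw win.
(* Windows are compared from their left ends, as in [block]. *)
suff: rpos n (z - Z.of_nat l) = rpos n (z' - Z.of_nat l).
  by move/(rposD (Z.of_nat l)); rewrite !Z.sub_add.
pose y := z - Z.of_nat l; pose y' := z' - Z.of_nat l; rewrite -/y -/y'.
have {}win t : (t <= 2 * l)%N -> letter n w (y + Z.of_nat t) = letter n w (y' + Z.of_nat t).
  move=> let2; have := win (Z.of_nat t - Z.of_nat l).
  replace (z + (Z.of_nat t - Z.of_nat l)) with (y + Z.of_nat t) by lia.
  by replace (z' + (Z.of_nat t - Z.of_nat l)) with (y' + Z.of_nat t) by lia; apply; lia.
have [s1 s2] : (1 < size W1)%N /\ (1 < size W2)%N by case: B1 B2 => ? _ _ _ [].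
(* A letter occurring only at position [e] locates any window that contains it. *)
have sepP e : (forall k, (k < size w)%N -> nth 0%N w k = nth 0%N w e -> k = e) ->
    forall x x' t, letter n w (x + Z.of_nat t) = letter n w (x' + Z.of_nat t) ->
    rpos n (x + Z.of_nat t) = e :> nat -> rpos n x = rpos n x'.
  move=> eU x x' t et ee; have := eU (rpos n (x' + Z.of_nat t)).
  rewrite sw ltn_ord -/(letter n w _) -et /letter ee => /(_ isT erefl) ee'.
  have /(rposD (- Z.of_nat t)) : rpos n (x + Z.of_nat t) = rpos n (x' + Z.of_nat t).
    by apply: val_inj; rewrite /= ee ee'.
  by rewrite !Z.add_opp_r !Z.add_simpl_r.
have inside x : (exists e t, [/\ (t <= 2 * l)%N, e = (size W1).-1 \/ e = (size w).-1 &
      rpos n (x + Z.of_nat t) = e :> nat]) \/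
    (forall t, (t <= 2 * l)%N -> rpos n (x + Z.of_nat t) = (rpos n x + t)%N :> nat) /\
    ((rpos n x + 2 * l < size W1)%N \/ (size W1 <= rpos n x)%N /\ (rpos n x + 2 * l < size w)%N).
  have rD t : (rpos n x + t < n.+3)%N -> rpos n (x + Z.of_nat t) = (rpos n x + t)%N :> nat.
    move=> lt; have -> : rpos n (x + Z.of_nat t) = rpos n (Z.of_nat (rpos n x + t)).
      by rewrite Nat2Z.inj_add; apply: rposD; rewrite rpos_ord.
    by rewrite (rpos_ord (Ordinal lt)).
  have ltx := ltn_ord (rpos n x); have sw' : (size W1 + size W2)%N = n.+3 by rewrite -size_cat.
  have [lt1|ge1] := ltnP (rpos n x) (size W1).
    have [le2|gt2] := leqP (size W1) (rpos n x + 2 * l).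
      left; exists (size W1).-1, ((size W1).-1 - rpos n x)%N; split; [lia | by left |].
      by rewrite rD; lia.
    by right; split; [move=> t let2; apply: rD; lia | left].
  have [le2|gt2] := leqP n.+3 (rpos n x + 2 * l).
    left; exists (size w).-1, ((size w).-1 - rpos n x)%N; split; [rewrite sw; lia | by right |].
    by rewrite rD sw; lia.
  by right; split; [move=> t let2; apply: rD; lia | right; rewrite sw].
have sep x x' : (forall t, (t <= 2 * l)%N ->
      letter n w (x + Z.of_nat t) = letter n w (x' + Z.of_nat t)) ->
   (exists e t, [/\ (t <= 2 * l)%N, e = (size W1).-1 \/ e = (size w).-1 &
      rpos n (x + Z.of_nat t) = e :> nat]) -> rpos n x = rpos n x'.
  move=> winx [e [t [let2 [ee0|ee0] ee]]]; apply: sepP (winx t let2) ee; rewrite ee0.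
  - by move=> k; apply: last_unique1.
  - by move=> k; apply: last_unique2.
have [/(sep y y' win)//|[ry iny]] := inside y.
have [/(sep y' y (fun t h => esym (win t h)))->//|[ry' iny']] := inside y'.
apply: val_inj => /=.
have {}win t : (t <= 2 * l)%N -> nth 0%N w (rpos n y + t) = nth 0%N w (rpos n y' + t).
  by move=> let2; have := win t let2; rewrite /letter ry // ry'.
have memW1 (i : nat) : (i < size W1)%N -> nth 0%N w i \in W1.
  by move=> lti; rewrite nth_cat lti nth_in.
have memW2 (i : nat) : (size W1 <= i)%N -> (i < size w)%N -> nth 0%N w i \in W2.
  by rewrite size_cat => lei lti; rewrite nth_cat ltnNge lei nth_in //; lia.
have win0 := win 0%N isT; rewrite !addn0 in win0.
case: iny iny' => [lty|[gey lty]] [lty'|[gey' lty']].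
- case: B1 => _ _ _; apply=> // t let2; have := win t let2; rewrite !nth_cat.
  by do 2 (rewrite ifT; last by lia).
- have := memW1 (rpos n y); rewrite win0 => /(_ ltac:(lia))/disj/negP[].
  by apply: memW2 => //; rewrite sw.
- have := memW1 (rpos n y'); rewrite -win0 => /(_ ltac:(lia))/disj/negP[].
  by apply: memW2 => //; rewrite sw.
- move: lty lty'; rewrite size_cat => lty lty'.
  suff: (rpos n y - size W1)%N = (rpos n y' - size W1)%N by lia.
  case: B2 => _ _ _; apply; [lia | lia |] => t let2; have := win t let2; rewrite !nth_cat.
  do 2 (rewrite ifF; last by lia).
  by rewrite -!addnBAC.
Qed.

End TwoBlocks.

(** * Leader election on rings and exclusion of advice strings *)

Section Election.

Variables (A : algorithm) (tb : nat -> nat -> nat) (T : nat -> nat).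
Hypothesis tbP : forall D phi d r, (D <= d)%N -> (phi <= r)%N -> (tb D phi <= d + T r)%N.
Hypothesis T_ge : forall r, (r <= T r)%N.
Hypothesis electsA : elects_within A tb.

(** Unlike [outputs_at], this refers to a sequence of views and not to a graph, so that it can be
    transferred between words agreeing on a window. *)
Definition outputs (a : seq bool) (V : nat -> view) (t : nat) (s : seq nat) : Prop :=
  exists r, [/\ (r <= t)%N, decide A a r (V r) = Some s
              & forall r', (r' < r)%N -> decide A a r' (V r') = None].

Lemma outputs_unique a V t t' s s' : outputs a V t s -> outputs a V t' s' -> s = s'.
Proof.
move=> [r [_ os minr]] [r' [_ os' minr']].
case: (ltngtP r r') => [/minr'|/minr|er]; [by rewrite os | by rewrite os' |].
by move: os'; rewrite -er os => -[].
Qed.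

Lemma outputs_ext a V V' t s :
  (forall r, (r <= t)%N -> V r = V' r) -> outputs a V t s -> outputs a V' t s.
Proof.
move=> eV [r [ler os minr]]; exists r; split=> //; first by rewrite -eV.
by move=> r' ltr; rewrite -eV ?minr //; lia.
Qed.

Section RingElection.

Variables (n : nat) (w : seq nat) (l : nat).
Hypothesis winU : forall z z',
  same_window (letter n w) (letter n w) z z' l -> rpos n z = rpos n z'.

Local Notation G := (ring n w).
Local Notation f := (letter n w).

(** Here [n.+3./2 + 2] bounds the diameter, two leaf edges included, and [l.+1] the election
    index. *)
Definition ring_time : nat := (n.+3./2 + 2 + T l.+1)%N.

Lemma ring_election_index : exists2 phi, (phi <= l.+1)%N & election_index G phi.
Proof. exact: (election_index_exists (aug_view_ring_inj winU)). Qed.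

(** The leader may be a leaf; [i0] is the ring position it belongs to. *)
Lemma ring_outputs : exists i0 : 'I_n.+3, forall z, exists s,
  outputs (oracle A G) (fun r => rview f r z) ring_time s /\ rpos n (z + displacement s) = i0.
Proof.
have [phi lephi elG] := ring_election_index.
have wfG := wf_ring n w.
have [||D leD diamG] := @diameter_exists G (n.+3./2 + 2); first by case: wfG.
  move=> u v; have [k lek wk] := fwalk_ring_diameter (enum_val u) (enum_val v).
  by exists k; rewrite // -(enum_valK u) -(enum_valK v); apply: walk_fgraph.
have [v0 elect] := electsA wfG diamG elG; exists (tag (enum_val v0)) => z.
have [r [s [ler [os minr] [vs [etr _ lastvs]]]]] := elect (enum_rank (rnode w (rpos n z))).
exists s; split.
  exists r; split; first by apply: leq_trans ler (tbP leD lephi).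
    by rewrite -aug_view_rnode.
  by move=> r' ltr; rewrite -aug_view_rnode; apply: minr.
by rewrite -lastvs; apply/esym/trace_displacement; rewrite // enum_rankK.
Qed.

(* Otherwise displacements drop by exactly one along the ring, hence by its
   length after a full turn, although one is then back at the same node. *)
Lemma ring_conflict : exists z s s',
  [/\ displacement s <> 1 + displacement s',
      outputs (oracle A G) (fun r => rview f r z) ring_time s
    & outputs (oracle A G) (fun r => rview f r (z + 1)) ring_time s'].
Proof.
apply: NNPP => noconf; have [i0 outs] := ring_outputs.
have step1 z s s' : outputs (oracle A G) (fun r => rview f r z) ring_time s ->
    outputs (oracle A G) (fun r => rview f r (z + 1)) ring_time s' ->
    displacement s = 1 + displacement s'.
  by move=> os os'; apply: NNPP => ne; apply: noconf; exists z, s, s'.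
have turn k s s' : outputs (oracle A G) (fun r => rview f r 0) ring_time s ->
    outputs (oracle A G) (fun r => rview f r (Z.of_nat k)) ring_time s' ->
    displacement s = Z.of_nat k + displacement s'.
  elim: k s' => [|k IHk] s' os os'; first by rewrite (outputs_unique os os').
  have [s1 [os1 _]] := outs (Z.of_nat k).
  rewrite (IHk _ os os1) (step1 _ _ s' os1) ?Nat2Z.inj_succ; first by lia.
  by rewrite Nat2Z.inj_succ in os'.
have [s [os _]] := outs 0.
have : outputs (oracle A G) (fun r => rview f r (Z.of_nat n.+3)) ring_time s.
  apply: outputs_ext os => r _; apply: rview_window => t _.
  by congr nth; congr nat_of_ord; apply/rpos_eq; exists 1; lia.
by move/(turn _ _ _ os); lia.
Qed.

End RingElection.

(** Wherever [W] occurs, advice [a] makes two adjacent nodes point to positions that differ, but by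
    less than [size W]; on a ring at least that long these positions cannot coincide. *)
Definition kills (a : seq bool) (W : seq nat) : Prop :=
  exists p s s', [/\ displacement s <> 1 + displacement s',
    Z.abs (displacement s - (1 + displacement s')) < Z.of_nat (size W)
  & forall f o, occurs W f o -> exists t,
      outputs a (fun r => rview f r (o + p)) t s /\
      outputs a (fun r => rview f r (o + p + 1)) t s'].

Lemma kills_factor a W W' q : (size W <= size W')%N ->
  (forall f o, occurs W' f o -> occurs W f (o + q)) -> kills a W -> kills a W'.
Proof.
move=> leW sub [p [s [s' [ne small kill]]]]; exists (q + p), s, s'; split=> //; first by lia.
by move=> f o /sub/kill; rewrite !Z.add_assoc.
Qed.

(** With advice [a] both nodes would have to reach the same ring position, so their targets would be
    congruent modulo the length, hence equal by [rpos_small]. *)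
Lemma kills_ring a W n w l o :
  (forall z z', same_window (letter n w) (letter n w) z z' l -> rpos n z = rpos n z') ->
  (size W <= n.+3)%N -> occurs W (letter n w) o -> kills a W -> oracle A (ring n w) <> a.
Proof.
move=> winU leW occ [p [s [s' [ne small /(_ _ _ occ)[t [os os']]]]]] ea.
have [i0 outs] := ring_outputs winU; rewrite ea in outs.
have [s1 [os1 es]] := outs (o + p); have [s1' [os1' es']] := outs (o + p + 1).
rewrite (outputs_unique os1 os) in es; rewrite (outputs_unique os1' os') in es'.
apply: ne; have := rpos_small (etrans es (esym es')).
by lia.
Qed.

Definition excludable (S : seq (seq bool)) (l : nat) : Prop :=
  forall N, exists2 W, block N l W & {in S, forall a, kills a W}.

Lemma excludable0 : excludable [::] 0.
Proof.
move=> N; exists [:: N; N.+1] => //; split=> //=; first by rewrite leqnn leqnSn.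
  by case=> [|[|k]] //=; lia.
move=> i j; rewrite !addn0 => lti ltj /(_ 0%N isT); rewrite !addn0.
by case: i lti => [|[|i]] //; case: j ltj => [|[|j]] //=; lia.
Qed.

(** Letters from [M] on are fresh, as they exceed the sum of [w], so a window ending among them is
    fixed by its last letter. A window ending before them starts at one of the first [n.+3]
    positions, which are distinct on the ring, and windows of the ring determine their position. *)
Lemma cut_block n w l z N P (r := (T l.+1 + 3)%N) (M := (N + sumn w).+1)
    (W := [seq letter n w (z + Z.of_nat k) | k <- iota 0 (n.+3 + 2 * r)] ++ iota M P.+2) :
  size w = n.+3 -> all (leq N) w ->
  (forall z z', same_window (letter n w) (letter n w) z z' l -> rpos n z = rpos n z') ->
  block N r W.
Proof.
move=> sw wN winU; set C := [seq _ | _ <- _] in W *.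
have sC : size C = (n.+3 + 2 * r)%N by rewrite size_map size_iota.
have sW : size W = (n.+3 + 2 * r + P.+2)%N by rewrite size_cat sC size_iota.
have nthC k : (k < n.+3 + 2 * r)%N -> nth 0%N W k = letter n w (z + Z.of_nat k).
  by move=> ltk; rewrite nth_cat sC ltk (nth_map 0%N) ?size_iota // nth_iota.
have nthP k : (n.+3 + 2 * r <= k)%N -> (k < size W)%N ->
    nth 0%N W k = (M + (k - (n.+3 + 2 * r)))%N.
  by rewrite sW => lek ltk; rewrite nth_cat sC ltnNge lek [~~ true]/= nth_iota; lia.
have ltM y : (letter n w y < M)%N.
  rewrite ltnS; apply: leq_trans (leq_addl _ _).
  by have := letter_mem y sw; move: (letter n w y) => a; elim: (w) => //= b u IHu;
    rewrite inE => /predU1P[->|/IHu]; lia.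
have sepP i j : (i < size W)%N -> (j < size W)%N -> nth 0%N W i = nth 0%N W j ->
    (i < n.+3 + 2 * r)%N && (j < n.+3 + 2 * r)%N \/ i = j.
  move=> lti ltj; case: (ltnP i (n.+3 + 2 * r)) => [lti'|gei];
    case: (ltnP j (n.+3 + 2 * r)) => [ltj'|gej]; first by left.
  - by rewrite nthC // nthP // => e; have := ltM (z + Z.of_nat i); rewrite e; lia.
  - by rewrite nthP // nthC // => e; have := ltM (z + Z.of_nat j); rewrite -e; lia.
  - by rewrite !nthP // => e; right; lia.
split.
- by rewrite sW; lia.
- apply/allP => a; rewrite mem_cat => /orP[/mapP[k _ ->]|].
    by move/allP: wN; apply; apply: letter_mem.
  by rewrite mem_iota => /andP[leM _]; apply: leq_trans leM; rewrite /M; lia.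
- move=> k ltk; rewrite -nth_last => /sepP[]; try lia.
- move=> i j lti ltj win; have := win (2 * r)%N (leqnn _).
  case/sepP=> // [/andP[ltiC ltjC]|]; last by lia.
  have lr : (l <= r)%N by have := T_ge l.+1; rewrite /r; lia.
  suff: z + Z.of_nat i = z + Z.of_nat j by lia.
  apply: (@rpos_small n); last by lia.
  (* The ring window of radius [l] centred at offset [l] fits into the [2 * r + 1] known letters
     because [l <= r]. *)
  have /(rposD (- Z.of_nat l)) :
      rpos n (z + Z.of_nat i + Z.of_nat l) = rpos n (z + Z.of_nat j + Z.of_nat l).
    apply: winU => t bt; have := win (Z.to_nat (Z.of_nat l + t)).
    rewrite !nthC; try lia.
    by move=> e; have := e ltac:(lia); congr (_ = _); congr letter; lia.
  by rewrite !Z.add_opp_r !Z.add_simpl_r.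
Qed.

(** Cutting the ring at [z] damages at most one of the two blocks; the other is met intact during
    one full turn from [z]. *)
Lemma surviving_block n W1 W2 z : size (W1 ++ W2) = n.+3 ->
  exists W q, [/\ W = W1 \/ W = W2, (q + size W <= n.+3)%N
                & occurs W (letter n (W1 ++ W2)) (z + Z.of_nat q)].
Proof.
move=> sw; have := sw; rewrite size_cat => sw'.
have start : rpos n (z - Z.of_nat (rpos n z)) = rpos n 0.
  have := rpos_ord (rpos n z) => /esym/(rposD (- Z.of_nat (rpos n z))).
  by rewrite !Z.add_opp_r Z.sub_diag.
have ltz := ltn_ord (rpos n z).
have [le1|gt1] := leqP (rpos n z) (size W1).
  exists W2, (size W1 - rpos n z)%N; split; [by right | lia |].
  have := occurs_catr (letter_occurs sw start).
  by congr occurs; lia.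
exists W1, (n.+3 - rpos n z)%N; split; [by left | lia |].
apply: (@occurs_catl _ W2); apply: letter_occurs => //; rewrite -start.
by apply/rpos_eq; exists (-1); lia.
Qed.

Lemma excludable_extend S l N : excludable S l ->
  exists G W, [/\ wf_graph G, exists2 phi, (phi <= l.+1)%N & election_index G phi,
    oracle A G \notin S, block N (T l.+1 + 3) W &
    {in oracle A G :: S, forall a, kills a W}].
Proof.
move=> exclS; have [W1 B1 kill1] := exclS N.
(* The letters of [W2] exceed the sum of [W1], hence every letter of [W1]. *)
have [W2 B2' kill2] := exclS (N + (sumn W1).+1)%N.
have B2 : block N l W2 by apply: block_weaken B2'; lia.
have disj a : a \in W1 -> a \notin W2.
  move=> aW1; apply/negP; case: B2' => _ /allP B2N _ _ /B2N.
  have: (a <= sumn W1)%N by elim: (W1) aW1 => //= b u IHu; rewrite inE => /predU1P[->|/IHu]; lia.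
  lia.
pose w := W1 ++ W2; pose n := (size w - 3)%N.
have sw : size w = n.+3.
  by case: B1 B2 => s1 _ _ _ [s2 _ _ _]; rewrite /n /w size_cat; lia.
have winU z z' := @two_blocks_window N l W1 W2 B1 B2 disj n z z' sw.
have occ1 : occurs W1 (letter n w) 0 by apply: occurs_catl (letter_occurs sw _).
exists (ring n w); have [z [s [s' [ne os os']]]] := ring_conflict winU.
set r := (T l.+1 + 3)%N; set t := ring_time n l in os os'.
(* The conflicting nodes together see the [2 * t + 2] letters from [z - t] to [z + 1 + t]; this
   dictates the summand 3 in [r]. *)
have tr : (2 * t + 2 <= n.+3 + 2 * r)%N by rewrite /t /ring_time /r; lia.
(* The fresh letters also pad [W] beyond the gap between the two targets, as [kills] demands. *)
pose P := Z.to_nat (Z.abs (displacement s - (1 + displacement s'))).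
pose W := [seq letter n w (z - Z.of_nat t + Z.of_nat k) | k <- iota 0 (n.+3 + 2 * r)] ++
            iota (N + sumn w).+1 P.+2.
have sW : size W = (n.+3 + 2 * r + P.+2)%N by rewrite size_cat size_map !size_iota.
have occW f o k : occurs W f o -> (k < n.+3 + 2 * r)%N ->
    f (o + Z.of_nat k) = letter n w (z - Z.of_nat t + Z.of_nat k).
  move=> /occurs_catl occ ltk; rewrite occ ?size_map ?size_iota //.
  by rewrite (nth_map 0%N) ?size_iota // nth_iota.
exists W; split.
- exact: wf_ring.
- exact: ring_election_index winU.
- apply/negP => inS; have := kills_ring winU _ occ1 (kill1 _ inS).
  by apply=> //; move: sw; rewrite size_cat; lia.
- by apply: cut_block => //; rewrite all_cat; case: B1 B2 => _ -> _ _ [_ -> _ _].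
- move=> a; rewrite inE => /predU1P[->|inS].
    (* [W] starts reading the ring at [z - t], so the node [z] sits at offset [t]. *)
    exists (Z.of_nat t), s, s'; split=> //; first by rewrite sW /P; lia.
    move=> f o occ; exists t.
    have win y : z <= y <= z + 1 -> same_window (letter n w) f y (o + Z.of_nat t + (y - z)) t.
      move=> by_ u bu; have := occW f o (Z.to_nat (Z.of_nat t + (y - z) + u)) occ.
      move=> e; apply: esym; have := e ltac:(lia).
      by congr (_ = _); [congr f | congr letter]; lia.
    have sub y r' : z <= y <= z + 1 -> (r' <= t)%N ->
        rview (letter n w) r' y = rview f r' (o + Z.of_nat t + (y - z)).
      move=> by_ ler; apply: rview_window; apply: same_window_sub (win y by_) _ _; lia.
    split; [apply: outputs_ext os | apply: outputs_ext os'] => r' ler.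
      by rewrite sub //; [congr rview | ]; lia.
    by rewrite sub //; [congr rview | ]; lia.
  have [W0 [q [W0E leq0 occ0]]] := @surviving_block n W1 W2 (z - Z.of_nat t) sw.
  apply: (@kills_factor _ W0 _ (Z.of_nat q)); first by rewrite sW; lia.
    move=> f o occ k ltk; rewrite -occ0 //.
    have := occW f o (q + k)%N occ; rewrite Nat2Z.inj_add !Z.add_assoc; apply.
    by lia.
  by case: W0E => ->; [apply: kill1 | apply: kill2].
Qed.

(** Window radius of the blocks that exclude [m] strings; rings made of two of them have election
    index at most [(radius m).+1]. *)
Definition radius (m : nat) : nat := iter m (fun r => (T r.+1 + 3)%N) 0%N.

Lemma radius_leS m : (radius m <= radius m.+1)%N.
Proof. by have := T_ge (radius m).+1; rewrite /radius /=; lia. Qed.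

Lemma radius_le m m' : (m <= m')%N -> (radius m <= radius m')%N.
Proof. by move=> lem; apply: (homo_leq leqnn leq_trans radius_leS). Qed.

Lemma long_advice L alpha : ((radius (2 ^ L)).+1 <= alpha)%N ->
  exists G phi, [/\ wf_graph G, election_index G phi, (phi <= alpha)%N
                  & (L <= size (oracle A G))%N].
Proof.
move=> lea; apply: NNPP => none.
have short G phi : wf_graph G -> election_index G phi -> (phi <= alpha)%N ->
    oracle A G \in strings L.
  move=> wfG elG lephi; apply: mem_strings; rewrite ltnNge; apply/negP => leL.
  by apply: none; exists G, phi.
suff [S [uS subS sS _]] : exists S, [/\ uniq S, {subset S <= strings L},
    size S = (2 ^ L)%N & excludable S (radius (2 ^ L))].
  by have := uniq_leq_size uS subS; rewrite sS -size_strings ltnn.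
(* Keeping [m <= 2 ^ L] ensures that every ring built has election index at most [alpha], so that
   [short] applies to it. *)
elim: {-2}(2 ^ L)%N (leqnn (2 ^ L)) => [|m IHm] lem.
  by exists [::]; split=> //; apply: excludable0.
have [S [uS subS sS exclS]] := IHm (ltnW lem).
pose ext a N := a \notin S /\ exists2 W, block N (radius m.+1) W & {in a :: S, forall b, kills b W}.
have [| |a aL extA] := @pigeonhole_antitone _ (strings L) ext.
- move=> a N N' leN [aS [W BW killW]]; split=> //; exists W => //.
  exact: block_weaken BW.
- move=> N; have [G [W [wfG [phi lephi elG] oS BW killW]]] := excludable_extend N exclS.
  exists (oracle A G); last by split=> //; exists W.
  apply: short wfG elG _; apply: leq_trans lephi _.
  by apply: leq_trans lea; rewrite ltnS; apply: radius_le; apply: ltnW.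
exists (a :: S); split=> /=.
- by rewrite uS; case: (extA 0%N) => ->.
- by move=> b; rewrite inE => /predU1P[->|/subS].
- by rewrite sS.
- by move=> N; case: (extA N).
Qed.

End Election.

(* Logarithms, towers and asymptotic bounds *)
Local Close Scope Z_scope.

Lemma INR_exp2 k : INR (2 ^ k) = pow 2 k.
Proof. by elim: k => // k IHk; rewrite expnS -multE mult_INR IHk. Qed.

Lemma ln_INR_exp2 k : ln (INR (2 ^ k)) = Rmult (INR k) (ln 2).
Proof. by rewrite INR_exp2 ln_pow //; lra. Qed.

(* For [x <= 0] this holds because [ln x] is then the junk value [0]. *)
Lemma log2_le (x : R) k : Rle x (INR (2 ^ k)) -> Rle (log2 x) (INR k).
Proof.
move=> lex; have ln2 := ln_lt_2; have k0 := pos_INR k; rewrite /log2.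
apply: (Rmult_le_reg_r (ln 2)); first by lra.
rewrite /Rdiv Rmult_assoc Rinv_l ?Rmult_1_r; last by lra.
have [x0|x0] := Rlt_le_dec 0 x; first rewrite -ln_INR_exp2.
  by case: lex => [/(ln_increasing _ _ x0)/Rlt_le|->] //; apply: Rle_refl.
have -> : ln x = IZR 0 by rewrite /ln; case: Rlt_dec => // /Rlt_not_le[].
by apply: Rmult_le_pos; lra.
Qed.

Lemma exp2_le (x : R) k : Rlt 0 x -> Rle (INR k) (log2 x) -> Rle (INR (2 ^ k)) x.
Proof.
move=> x0; rewrite /log2 => lek; have ln2 := ln_lt_2.
apply: Rnot_lt_le => ltx; have := ln_increasing _ _ x0 ltx; rewrite ln_INR_exp2 => lt.
have : Rlt (Rdiv (ln x) (ln 2)) (INR k); last by lra.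
by apply: (Rmult_lt_reg_r (ln 2)); [lra | rewrite /Rdiv Rmult_assoc Rinv_l; lra].
Qed.

Fixpoint tower (h : nat) : nat := if h is h'.+1 then 2 ^ tower h' else 1.

Lemma tower_ltS h : tower h < tower h.+1.
Proof. exact: ltn_expl. Qed.

Lemma leq_tower h h' : (tower h <= tower h') = (h <= h').
Proof. exact: (leq_mono (homo_ltn ltn_trans tower_ltS)). Qed.

Lemma tower_gt h : h < tower h.
Proof. by elim: h => // h IHh; apply: leq_ltn_trans IHh (tower_ltS h). Qed.

(** The value [h.+1] means that the [h]-fold iterated logarithm of [x] still exceeds 1;
    exponentiating back gives the tower. *)
Lemma tower_logstar_fuel f x h : logstar_fuel f x = h.+1 -> Rle (INR (tower h)) x.
Proof.
elim: f x h => //= f IHf x h; case: Rle_dec => // xgt1 [].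
case: h => [_|h /IHf le]; first by rewrite /=; lra.
by apply: exp2_le; first by lra.
Qed.

Lemma logstar_le a h : a < tower h -> logstar a <= h.
Proof.
move=> lta; case e: (logstar a) => [|h'] //.
have /INR_le/leP le := tower_logstar_fuel e.
by have := leq_ltn_trans le lta; rewrite ltnNge leq_tower -ltnNge.
Qed.

(** [B] plays the role of an inverse of [g]. For the least [k] with [a < B k], [g a] is at most [k]
    while the advice has size at least [k - C.+1]. *)
Lemma advice_lower_bound_growth A g (B : nat -> nat) C :
  {homo B : k k' / k <= k'} -> (forall k, k < B k) ->
  (forall k a, a < B k -> Rle (g a) (INR k)) ->
  (forall L a, B (L + C) <= a -> exists G phi,
     [/\ wf_graph G, election_index G phi, phi <= a & L <= size (oracle A G)]) ->
  advice_lower_bound A g.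
Proof.
move=> Bmono Blt gB adv.
(* Once [k >= C + 2], which [a >= B (C + 1)] guarantees, [k <= (C + 2) * (k - C.+1)]. *)
exists (Rinv (INR (C + 2))); split; first by apply/Rinv_0_lt_compat/lt_0_INR; lia.
exists (B (C + 1)) => a lea.
have [k lek [lta mink]] := exists_least (P := fun k => is_true (a < B k)) (Blt a).
have ltk : C + 1 < k.
  by rewrite ltnNge; apply/negP => /Bmono; rewrite leqNgt (leq_ltn_trans lea lta).
have [|G [phi [wfG elG lephi leL]]] := adv (k - C.+1) a.
  have -> : k - C.+1 + C = k.-1 by lia.
  by rewrite leqNgt; apply/negP/mink; lia.
exists G, phi; split=> //.
apply: (Rmult_le_reg_l (INR (C + 2))); first by apply: lt_0_INR; lia.
rewrite -Rmult_assoc Rinv_r ?Rmult_1_l; last by apply: not_0_INR; lia.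
apply: Rle_trans (gB k a lta) _; rewrite -mult_INR; apply: le_INR.
by nia.
Qed.

Lemma ltn_exp2l_self k : k < 2 ^ k.
Proof. exact: ltn_expl. Qed.

Lemma homo_exp2 : {homo expn 2 : k k' / k <= k'}.
Proof. by move=> k k' lek; rewrite leq_pexp2l. Qed.

(** * Growth of the radius under the four time bounds *)

Lemma radius_add c m : (radius (addn^~ c) m).+1 = m * (c + 4) + 1.
Proof.
elim: m => // m IHm.
have -> : radius (addn^~ c) m.+1 = (radius (addn^~ c) m).+1 + c + 3 by [].
by rewrite IHm; lia.
Qed.

Lemma radius_mul c m : (radius (muln c) m).+1 <= (c + 4) ^ m.
Proof.
elim: m => // m; set y := (radius _ m).+1 => IHm.
have -> : radius (muln c) m.+1 = c * y + 3 by [].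
by rewrite expnS; have : 0 < y by []; nia.
Qed.

(** The summand 4 makes the induction close, through [y ^ c + 8 <= (y + 4) ^ (c + 3)]; raising to
    the power [c + 3] multiplies the exponent of 2 by [c + 3]. *)
Lemma radius_exp c m : 0 < c -> (radius (expn^~ c) m).+1 + 4 <= 2 ^ ((c + 3) ^ m.+1).
Proof.
move=> c0; elim: m => [|m].
  by rewrite expn1 /radius /= expnD; have := ltn_exp2l_self c; lia.
set y := (radius _ m).+1 => IHm.
have -> : radius (expn^~ c) m.+1 = y ^ c + 3 by [].
have step : (y + 4) ^ (c + 3) <= 2 ^ ((c + 3) ^ m.+2).
  by rewrite [(c + 3) ^ _]expnSr expnM leq_exp2r // addn_gt0 c0.
apply: leq_trans step; rewrite expnD.
have : y ^ c <= (y + 4) ^ c by rewrite leq_exp2r // leq_addr.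
have : 4 ^ 3 <= (y + 4) ^ 3 by rewrite leq_exp2r // leq_addl.
have : 0 < (y + 4) ^ c by rewrite expn_gt0 addn_gt0 orbT.
by nia.
Qed.

Lemma radius_pow c m : 0 < c -> (radius (expn c) m).+1 <= tower (2 * c + 8 + m).
Proof.
(* The strengthened bound carries the factor [c] needed to replace base [c] by base 2, as
   [c ^ y <= 2 ^ (c * y)]. At [m = 0] its left side is [2 * c + 8], whence the initial height. *)
move=> c0; suff : c * (radius (expn c) m).+1 + c + 8 <= tower (2 * c + 8 + m) by nia.
elim: m => [|m]; first by rewrite addn0 /radius /=; have := tower_gt (2 * c + 8); lia.
set y := (radius _ m).+1 => IHm; rewrite [2 * c + 8 + m.+1]addnS [tower _.+1]/=.
apply: leq_trans (homo_exp2 IHm).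
have -> : radius (expn c) m.+1 = c ^ y + 3 by [].
have cy : c * c ^ y <= 2 ^ (c * y + c).
  rewrite expnD expnM mulnC; apply: leq_mul; last exact: ltnW (ltn_exp2l_self c).
  by rewrite leq_exp2r //; apply: ltnW (ltn_exp2l_self c).
have le2 : 2 ^ c <= 2 ^ (c * y + c) by rewrite leq_pexp2l // leq_addl.
by have := ltn_exp2l_self c; rewrite [2 ^ (_ + 8)]expnD; lia.
Qed.

Theorem theorem5 (c : nat) (hc : 1 < c) :
  (forall A : algorithm, elects_within A (fun D phi => D + phi + c) ->
     advice_lower_bound A (fun a => log2 (INR a))) /\
  (forall A : algorithm, elects_within A (fun D phi => D + c * phi) ->
     advice_lower_bound A (fun a => log2 (log2 (INR a)))) /\
  (forall A : algorithm, elects_within A (fun D phi => D + phi ^ c) ->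
     advice_lower_bound A (fun a => log2 (log2 (log2 (INR a))))) /\
  (forall A : algorithm, elects_within A (fun D phi => D + c ^ phi) ->
     advice_lower_bound A (fun a => log2 (INR (logstar a)))).
Proof.
have c0 : 0 < c := ltnW hc; have exp2_gt := ltn_exp2l_self.
have ltINR a k : a < 2 ^ k -> Rle (INR a) (INR (2 ^ k)) by move=> lta; apply: le_INR; lia.
split; [|split; [|split]] => A electsA.
(* The shift [c + 5] absorbs the constants: [2 ^ L * (c + 4) + 1 <= 2 ^ (L + (c + 5))]. The other
   three cases choose their shifts likewise. *)
- apply: (@advice_lower_bound_growth _ _ (expn 2) (c + 5)) => //.
  + exact: homo_exp2.
  + by move=> k a lta; apply/log2_le/ltINR.
  move=> L a lea; apply: (long_advice _ _ electsA (T := addn^~ c)); [lia | lia |].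
  apply: leq_trans lea; rewrite radius_add expnD.
  by have := exp2_gt (c + 5); have := expn_gt0 2 L; nia.
- apply: (@advice_lower_bound_growth _ _ (fun k => 2 ^ (2 ^ k)) (c + 4)).
  + by move=> k k' lek; do 2 apply: homo_exp2.
  + by move=> k; apply: ltn_trans (exp2_gt k) _.
  + by move=> k a lta; do 2 apply: log2_le; apply: ltINR.
  move=> L a lea; apply: (long_advice _ _ electsA (T := muln c)) => //; [nia | nia |].
  apply: leq_trans lea; apply: leq_trans (radius_mul c _) _.
  have -> : 2 ^ (2 ^ (L + (c + 4))) = (2 ^ (2 ^ (c + 4))) ^ (2 ^ L).
    by rewrite -expnM -expnD [L + _]addnC.
  by rewrite leq_exp2r ?expn_gt0 //; apply: ltnW; apply: ltn_trans (exp2_gt _) _.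
- apply: (@advice_lower_bound_growth _ _ (fun k => 2 ^ (2 ^ (2 ^ k))) (c + 4)).
  + by move=> k k' lek; do 3 apply: homo_exp2.
  + by move=> k; apply: ltn_trans (exp2_gt k) (ltn_trans (exp2_gt _) (exp2_gt _)).
  + by move=> k a lta; do 3 apply: log2_le; apply: ltINR.
  move=> L a lea; apply: (long_advice _ _ electsA (T := expn^~ c)).
  + by move=> D phi d r leD lephi; rewrite leq_add // leq_exp2r.
  + by case=> // r; rewrite -{1}(expn1 r.+1) leq_pexp2l.
  apply: leq_trans lea; apply: leq_trans (leq_addr 4 _) (leq_trans (radius_exp _ c0) _).
  apply: homo_exp2; apply: (@leq_trans ((2 ^ (c + 3)) ^ (2 ^ L).+1)).
    by rewrite leq_exp2r // ltnW.
  rewrite -expnM; apply: homo_exp2.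
  have -> : L + (c + 4) = (c + 3) + L.+1 by lia.
  by rewrite expnD; apply: leq_mul; [exact: ltnW | rewrite expnS; have := expn_gt0 2 L; lia].
- apply: (@advice_lower_bound_growth _ _ (fun k => tower (2 ^ k)) (2 * c + 8)).
  + by move=> k k' lek; rewrite leq_tower homo_exp2.
  + by move=> k; apply: ltn_trans (exp2_gt k) (tower_gt _).
  + by move=> k a /logstar_le le; apply: log2_le; apply: le_INR; lia.
  move=> L a lea; apply: (long_advice _ _ electsA (T := expn c)).
  + by move=> D phi d r leD lephi; rewrite leq_add // leq_pexp2l.
  + by move=> r; apply/ltnW/ltn_expl.
  (* Only the heights are compared: [2 * c + 8 + 2 ^ L <= 2 ^ (L + (2 * c + 8))]. *)
  apply: leq_trans lea; apply: leq_trans (radius_pow _ c0) _; rewrite leq_tower expnD.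
  by have := exp2_gt (2 * c + 8); have := expn_gt0 2 L; nia.
Qed.
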